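(* Let $G$ be a connected finite simple graph on $n \geq 3$ vertices. Then $\gamma_{gr}^L(G) = 2$ if and only if $G$ is the complete graph $K_n$.
   Context: For a vertex $v$, $N(v)$ is its open neighborhood (the set of its neighbors) and $N[v] = N(v) \cup \{v\}$ its closed neighborhood. An L-sequence of $G$ is a sequence $(v_1, \ldots, v_k)$ of distinct vertices of $G$ such that for every $i \in \{1,\ldots,k\}$, $N[v_i] \setminus \bigcup_{j=1}^{i-1} N(v_j) \neq \emptyset$. The L-Grundy domination number $\gamma_{gr}^L(G)$ is the maximum length of an L-sequence of $G$. *)

(* Defs.v *)
From mathcomp Require Import all_boot.

Set Implicit Arguments.
Unset Strict Implicit.
Unset Printing Implicit Defensive.

(* A finite simple graph on the vertex type T is a symmetric irreflexive
   adjacency relation e : rel T. *)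

Definition simple_graph (T : finType) (e : rel T) : Prop :=
  symmetric e /\ irreflexive e.

Definition connected_graph (T : finType) (e : rel T) : Prop :=
  forall x y : T, connect e x y.

Definition complete_graph (T : finType) (e : rel T) : Prop :=
  forall x y : T, x != y -> e x y.

Definition open_nbhd (T : finType) (e : rel T) (v : T) : {set T} :=
  [set w | e v w].

Definition closed_nbhd (T : finType) (e : rel T) (v : T) : {set T} :=
  v |: open_nbhd e v.

Definition L_sequence (T : finType) (e : rel T) (k : nat) (s : k.-tuple T)
    : bool :=
  uniq s &&
  [forall i : 'I_k,
     closed_nbhd e (tnth s i)
       :\: \bigcup_(j < k | j < i) open_nbhd e (tnth s j) != set0].

(* L-sequences have distinct entries, so restricting to lengths k <= #|T| loses
   nothing; see L_sequence_le_L_grundy and L_grundy_attained. *)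
Definition L_grundy (T : finType) (e : rel T) : nat :=
  \max_(k < #|T|.+1 | [exists s : k.-tuple T, L_sequence e s]) k.

Lemma L_sequence_le_L_grundy (T : finType) (e : rel T) (k : nat)
    (s : k.-tuple T) :
  L_sequence e s -> k <= L_grundy e.
Proof.
move=> Ls; have lek : k < #|T|.+1.
  by case/andP: Ls => us _; rewrite ltnS -(size_tuple s) -(card_uniqP us) max_card.
by apply: (@leq_bigmax_cond _ _ (fun k : 'I__ => k : nat) (Ordinal lek));
  apply/existsP; exists s.
Qed.

Lemma L_grundy_attained (T : finType) (e : rel T) :
  exists s : (L_grundy e).-tuple T, L_sequence e s.
Proof.
have ex0 : [exists s : (@ord0 #|T|).-tuple T, L_sequence e s].
  apply/existsP; exists (nil_tuple T).
  by apply/andP; split=> //; apply/forallP => -[].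
rewrite /L_grundy (bigop.bigmax_eq_arg ord0) //.
by case: arg_maxnP => //= k /existsP.
Qed.

(* Main.v *)
Require Import Defs.
From mathcomp Require Import all_boot.

(** In a complete graph the open neighborhoods of any two distinct vertices
    already cover everything, so no L-sequence has a third term.  Conversely, if
    [x] and [z] are distinct and nonadjacent and [y] is a neighbor of [x], then
    [(x, z, y)] is an L-sequence: [x] lies in [N[y]] but in neither [N(x)] nor
    [N(z)]. *)

(** A path from [x] to [z] is nonempty because [x != z]; its first step is the edge. *)
Lemma connected_neighbor (T : finType) (e : rel T) (x z : T) :
  connected_graph e -> x != z -> exists y, e x y.
Proof.
move=> /(_ x z) /connectP[[|y p] /= + ->]; first by rewrite eqxx.
by case/andP=> exy _ _; exists y.
Qed.

(** The vertex [x] is a witness for both terms: it lies in $N[x]$ and in $N[y]$, but not in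
    $N(x)$. *)
Lemma L_sequence_adjacent_pair (T : finType) (e : rel T) (x y : T) :
  simple_graph e -> e x y -> L_sequence e [tuple x; y].
Proof.
case=> sym_e irr_e exy; apply/andP; split.
  by rewrite /= inE andbT; apply: contraTN exy => /eqP->; rewrite irr_e.
apply/forallP=> i; apply/set0Pn; exists x; rewrite !inE; apply/andP; split.
  apply/bigcupP=> -[j ltji]; rewrite inE.
  by case: i j ltji => [[|[|//]] ?] [[|[|//]] ?] //= _; rewrite (tnth_nth x) /= irr_e.
by case: i => [[|[|//]] ?]; rewrite (tnth_nth x) /= ?eqxx // sym_e exy orbT.
Qed.

Lemma L_sequence_nonadjacent (T : finType) (e : rel T) (x y z : T) :
  simple_graph e -> x != z -> ~~ e x z -> e x y ->
  L_sequence e [tuple x; z; y].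
Proof.
case=> sym_e irr_e neq_xz nexz exy; apply/andP; split.
  rewrite /= !inE negb_or neq_xz andbT /=; apply/andP; split.
    by apply: contraTneq exy => <-; rewrite irr_e.
  by apply: contraTneq exy => <-.
apply/forallP=> i; apply/set0Pn.
(* The middle term [z] is its own witness; [x] serves the first and third terms. *)
exists (if i == 1 :> nat then z else x); rewrite !inE; apply/andP; split.
  apply/bigcupP=> -[j ltji]; rewrite inE.
  (* The pairs [(i, j)] left are (1,0), (2,0) and (2,1). *)
  case: i j ltji => [[|[|[|//]]] ?] [[|[|[|//]]] ?] //= _; rewrite (tnth_nth x) /=.
  - exact/negP.
  - by rewrite irr_e.
  - by rewrite sym_e; apply/negP.
by case: i => [[|[|[|//]]] ?]; rewrite (tnth_nth x) /= ?eqxx // sym_e exy orbT.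
Qed.

Lemma complete_L_sequence_le2 (T : finType) (e : rel T) (k : nat)
    (s : k.-tuple T) :
  complete_graph e -> L_sequence e s -> k <= 2.
Proof.
move=> ce /andP[us /forallP Ls]; rewrite leqNgt; apply/negP=> k_gt2.
have k_gt1 := ltnW k_gt2; have k_gt0 := ltnW k_gt1.
have /set0Pn[w] := Ls (Ordinal k_gt2).
rewrite inE => /andP[/bigcupP Nw _]; apply: Nw.
have neq01 : tnth s (Ordinal k_gt0) != tnth s (Ordinal k_gt1).
  have x0 := tnth s (Ordinal k_gt0).
  by rewrite !(tnth_nth x0) nth_uniq ?size_tuple.
(* The witness [w] of the third term is adjacent to whichever of the first two terms differs from
   it. *)
have [eqw|neqw] := eqVneq (tnth s (Ordinal k_gt0)) w.
  by exists (Ordinal k_gt1); rewrite // inE ce // -eqw eq_sym.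
by exists (Ordinal k_gt0); rewrite // inE ce.
Qed.

Theorem theorem3p2 (T : finType) (e : rel T) :
  simple_graph e -> connected_graph e -> 3 <= #|T| ->
  (L_grundy e = 2 <-> complete_graph e).
Proof.
move=> se conn_e T_ge3; split=> [gr2 x z neq_xz | ce].
  apply: contraT => nexz; have [y exy] := connected_neighbor _ _ _ _ conn_e neq_xz.
  have := L_sequence_le_L_grundy
    (L_sequence_nonadjacent _ _ _ _ _ se neq_xz nexz exy).
  by rewrite gr2.
have [s Ls] := L_grundy_attained e.
apply/eqP; rewrite eqn_leq (complete_L_sequence_le2 _ _ _ _ ce Ls) /=.
(* Lower bound: two distinct vertices, adjacent by completeness, form an L-sequence. *)
have /card_gt1P[x [y [_ _ neq_xy]]] : 1 < #|T| := ltnW T_ge3.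
exact: L_sequence_le_L_grundy
  (L_sequence_adjacent_pair _ _ _ _ se (ce _ _ neq_xy)).
Qed.
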